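(* Let $G=(V,E)$ be a connected, unweighted, undirected graph with $n=|V|>4$. Let $\phi^*$ be the minimum sparsest cut score for $G$ and assume that each side of the optimal sparsest cut partition $\{S^*,V\setminus S^*\}$ has at least $2$ nodes. Let $\gamma>0$ and $\lambda\in(0,1)$. Let $\mathbf{c}=(c_{ij})_{i<j}$ with $c_{ij}=1$ if $(i,j)\in E$ and $c_{ij}=0$ otherwise, and let $\mathbf{W}=\operatorname{diag}(\mathbf{w})$ with $\mathbf{w}=(w_{ij})_{i<j}$, $w_{ij}=1$ if $(i,j)\in E$ and $w_{ij}=\lambda$ otherwise. Let $\mathcal{A}$ denote the set of vectors $\mathbf{x}=(x_{ij})_{i<j}$ satisfying the constraints of the Leighton–Rao LP relaxation for sparsest cut: $$\sum_{i<j}x_{ij}=n,\qquad x_{ij}\le x_{ik}+x_{jk}\ \text{for all } i,j,k,\qquad x_{ij}\ge 0\ \text{for all } i,j.$$ Then $$\min_{\mathbf{x}\in\mathcal{A}}\ \mathbf{c}^T\mathbf{x}+\frac{1}{2\gamma}\mathbf{x}^T\mathbf{W}\mathbf{x}\ \le\ \left(1+\frac{1+\lambda n}{2\gamma}\right)\phi^*.$$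
   Context: For a nonempty proper subset $S\subset V$ with complement $\bar S=V\setminus S$, let $\mathrm{cut}(S)$ be the number of edges between $S$ and $\bar S$. The sparsest cut score is $\phi(S)=\frac{\mathrm{cut}(S)}{|S|}+\frac{\mathrm{cut}(S)}{|\bar S|}=\frac{n\,\mathrm{cut}(S)}{|S||\bar S|}$, and $\phi^*=\min_{S}\phi(S)$ over nonempty proper subsets; $S^*$ denotes a set attaining the minimum. The variables $x_{ij}$ are real and indexed by unordered pairs of distinct nodes ($x_{ij}=x_{ji}$); ''for all $i,j$'' and ''for all $i,j,k$'' range over distinct nodes. *)

(* Defs.v *)
From HB Require Import structures.
From mathcomp Require Import all_boot all_order all_algebra.
From mathcomp Require Import classical_sets reals.

Set Implicit Arguments.
Unset Strict Implicit.
Unset Printing Implicit Defensive.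

Import Order.TTheory GRing.Theory Num.Theory.
Local Open Scope classical_set_scope.
Local Open Scope ring_scope.

(* The value m is the minimum of f over D; in particular it is attained. *)
Definition is_min_of (R : realType) (T : Type) (f : T -> R) (D : set T)
    (m : R) : Prop :=
  (f @` D) m /\ lbound (f @` D) m.

(* A simple undirected graph on V is a symmetric irreflexive e : rel V. *)
Definition connected_graph (V : finType) (e : rel V) : Prop :=
  forall u v : V, connect e u v.

(* An edge between S and its complement is counted once, oriented out of S. *)
Definition cut (V : finType) (e : rel V) (S : {set V}) : nat :=
  #|[set p : V * V | [&& p.1 \in S, p.2 \notin S & e p.1 p.2]]%SET|.

Definition proper_cut (V : finType) : set {set V} :=
  [set S : {set V} | S != finset.set0 /\ S != [set: V]%SET].

Definition phi (R : realType) (V : finType) (e : rel V) (S : {set V}) : R :=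
  (cut e S)%:R / #|S|%:R + (cut e S)%:R / #|~: S|%:R.

(* The nodes are ordered by their position in the enumeration of V. *)
Definition node_lt (V : finType) (i j : V) : bool :=
  (enum_rank i < enum_rank j)%N.

(* The pairs (i, j) with i < j, which index the coordinates of the vectors. *)
Notation node_pair V := {p : (V * V)%type | node_lt p.1 p.2}.

Notation pair_vector R V := 'cV[R]_#|{: node_pair V}|.

Definition pair_coord (R : realType) (V : finType) (x : pair_vector R V)
    (p : node_pair V) : R :=
  x (enum_rank p) ord0.

(* x_ij for an arbitrary ordering of the distinct nodes i and j, with the
   convention x_ij = x_ji; the junk value for i = j is 0. *)
Definition entry (R : realType) (V : finType) (x : pair_vector R V)
    (i j : V) : R :=
  if insub (i, j) is Some p then pair_coord x p
  else if insub (j, i) is Some p then pair_coord x p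
  else 0.

Definition cost_vector (R : realType) (V : finType) (e : rel V) :
    pair_vector R V :=
  \col_k (let p := val (enum_val k) in if e p.1 p.2 then 1 else 0).

Definition weight_vector (R : realType) (V : finType) (e : rel V) (lam : R) :
    pair_vector R V :=
  \col_k (let p := val (enum_val k) in if e p.1 p.2 then 1 else lam).

Definition weight_matrix (R : realType) (V : finType) (e : rel V) (lam : R) :
    'M[R]_#|{: node_pair V}| :=
  diag_mx (weight_vector e lam)^T.

Definition leighton_rao (R : realType) (V : finType) : set (pair_vector R V) :=
  [set x : pair_vector R V |
    [/\ \sum_(i : V) \sum_(j : V | node_lt i j) entry x i j = #|V|%:R,
        forall i j k : V, i != j -> i != k -> j != k ->
          entry x i j <= entry x i k + entry x j k
      & forall i j : V, i != j -> 0 <= entry x i j]].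

(* The products are 1 x 1 matrices, hence the projections to their entry. *)
Definition qp_objective (R : realType) (V : finType) (e : rel V)
    (gam lam : R) (x : pair_vector R V) : R :=
  ((cost_vector R e)^T *m x) ord0 ord0
  + 1 / (2 * gam) * (x^T *m weight_matrix e lam *m x) ord0 ord0.

(* Main.v *)
Require Import Defs.
From HB Require Import structures.
From mathcomp Require Import all_boot all_order all_algebra.
From mathcomp Require Import ring lra zify.
From mathcomp Require Import boolp classical_sets reals.
From mathcomp Require Import topology normedtype derive.

Set Implicit Arguments.
Unset Strict Implicit.
Unset Printing Implicit Defensive.

Import Order.TTheory GRing.Theory Num.Theory.
Local Open Scope ring_scope.

(** The bound is witnessed by a single feasible point. A proper subset S with
    s nodes, whose complement has t nodes, gives the cut vector: x_ij = c when
    S separates i and j, and x_ij = 0 otherwise, with c = n / (s t). It is a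
    multiple of a cut pseudometric, hence satisfies the triangle inequalities,
    and c is chosen so that the s t separated pairs contribute n in total
    ([cut_vector_feasible]). With k = cut(S), its linear cost is
    c k = phi(S), and its quadratic cost is
      c^2 (k + lam (s t - k)) = c ((1 - lam) c k + lam n),
    because c s t = n ([qp_objective_cut_vector]). Two facts turn this into the
    bound (1 + lam n) c k. When both sides have at least two nodes,
    s t >= s + t, that is c <= 1, which gives (1 - lam) c (c k) <= c k. Since
    the graph is connected, k >= 1, which gives lam n c <= lam n c k.
    ([qp_objective_cut_vector_le] carries this out.)

    That the minimum is attained is the extreme value theorem: the feasible
    region is closed, and it is bounded because the nonnegative coordinates
    have sum n. Compactness of boxes is a statement on row vectors, so the
    feasible region, which consists of column vectors, is studied through
    transposition ([leighton_rao_rows_compact], [qp_objective_min_exists]). *)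

(** * Sums over unordered pairs of nodes *)

Lemma node_lt_neq (V : finType) (i j : V) : node_lt i j -> i != j.
Proof. by apply: contraTneq => ->; rewrite /node_lt ltnn. Qed.

Lemma node_lt_total (V : finType) (i j : V) :
  i != j -> node_lt j i = ~~ node_lt i j.
Proof.
rewrite /node_lt -leqNgt ltn_neqAle => ij.
by rewrite (inj_eq val_inj) (inj_eq enum_rank_inj) eq_sym ij.
Qed.

(** Passes from the coordinates of a vector, along which the objective is
    defined, to the double sum over ordered nodes of the constraint. *)
Lemma sum_node_pair (M : nmodType) (V : finType) (F : V -> V -> M) :
  \sum_(k < #|{: node_pair V}|)
     F (val (enum_val k)).1 (val (enum_val k)).2
  = \sum_(i : V) \sum_(j : V | node_lt i j) F i j.
Proof.
rewrite -(big_enum_val (fun p : node_pair V => F (val p).1 (val p).2)) /=.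
rewrite pair_big_dep /=.
by rewrite -[LHS](big_sub (fun p : V * V => node_lt p.1 p.2)
  (fun p => F p.1 p.2)).
Qed.

Definition separates (V : finType) (S : {set V}) (i j : V) : bool :=
  (i \in S) != (j \in S).

(** Each separated pair is counted on the left in the node order, on the right
    from S to its complement; symmetry of F makes the orientation immaterial. *)
Lemma sum_separated (M : nmodType) (V : finType) (S : {set V})
    (F : V -> V -> M) (F_sym : forall i j, F i j = F j i) :
  \sum_(i : V) \sum_(j : V | node_lt i j)
     (if separates S i j then F i j else 0)
  = \sum_(i in S) \sum_(j in ~: S) F i j.
Proof.
(* G keeps the orientation out of S. Splitting its sum over all ordered pairs
   by the node order, and transposing the decreasing half, leaves on each
   increasing pair G i j + G j i, of which at most one term is not 0. *)
pose G i j := if (i \in S) && (j \notin S) then F i j else 0.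
have -> : \sum_(i in S) \sum_(j in ~: S) F i j = \sum_i \sum_j G i j.
  rewrite big_mkcond; apply: eq_bigr => i _; rewrite /G.
  case: (i \in S) => /=; last by rewrite big1.
  by rewrite big_mkcond; apply: eq_bigr => j _; rewrite inE.
have -> : \sum_i \sum_j G i j
    = \sum_i \sum_(j | node_lt i j) G i j
      + \sum_i \sum_(j | ~~ node_lt i j) G i j.
  by rewrite -big_split; apply: eq_bigr => i _; rewrite (bigID (node_lt i)).
have -> : \sum_i \sum_(j | ~~ node_lt i j) G i j
    = \sum_i \sum_(j | node_lt i j) G j i.
  rewrite [RHS](exchange_big_dep predT) //=; apply: eq_bigr => i _.
  rewrite [LHS]big_mkcond [RHS]big_mkcond; apply: eq_bigr => j _.
  have [->|ij] := eqVneq i j; last by rewrite (node_lt_total ij).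
  by rewrite /G; case: (j \in S); rewrite /= !if_same.
rewrite -big_split; apply: eq_bigr => i _.
rewrite -big_split; apply: eq_bigr => j _; rewrite /G /separates /=.
by case: (i \in S); case: (j \in S); rewrite /= ?addr0 ?add0r.
Qed.

(** * Cuts of a connected graph *)

Lemma cutE (R : pzSemiRingType) (V : finType) (e : rel V) (S : {set V}) :
  (cut e S)%:R = \sum_(i in S) \sum_(j in ~: S) (e i j)%:R :> R.
Proof.
rewrite /cut -sum1_card natr_sum pair_big_dep [LHS]big_mkcond [RHS]big_mkcond /=.
apply: eq_bigr => -[i j] _; rewrite !inE /=.
by case: (i \in S); case: (j \in S); case: (e i j).
Qed.

(** A set that no edge leaves is closed under the edge relation, hence under
    connectedness, so it cannot both contain a node and miss another. *)
Lemma cut_gt0 (V : finType) (e : rel V) (S : {set V}) :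
  symmetric e -> connected_graph e -> proper_cut S -> (0 < cut e S)%N.
Proof.
move=> e_sym e_conn [/set0Pn[u uS] SnT].
have [v vS] : exists v, v \notin S.
  by apply/existsP; rewrite -negb_forall; apply: contra SnT => /forallP S_all;
     apply/eqP/setP => v; rewrite S_all inE.
rewrite lt0n; apply/negP => /eqP /card0_eq cut0.
have S_closed : fingraph.closed e (mem S).
  move=> x y exy; apply/idP/idP => xy; apply/negPn/negP => nxy.
    by have := cut0 (x, y); rewrite !inE /= xy nxy exy.
  by have := cut0 (y, x); rewrite !inE /= xy nxy e_sym exy.
by have := closed_connect S_closed (e_conn u v); rewrite uS (negPf vS).
Qed.

(** * The objective and the cut vector *)

Lemma pair_coord_entry (R : realType) (V : finType) (x : pair_vector R V) k :
  x k ord0 = entry x (val (enum_val k)).1 (val (enum_val k)).2.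
Proof.
by rewrite /entry -surjective_pairing valK /pair_coord enum_valK.
Qed.

Lemma qp_objectiveE (R : realType) (V : finType) (e : rel V) (gam lam : R)
    (x : pair_vector R V) :
  qp_objective e gam lam x =
    \sum_k cost_vector R e k ord0 * x k ord0
    + 1 / (2 * gam) * \sum_k weight_vector e lam k ord0 * x k ord0 ^+ 2.
Proof.
rewrite /qp_objective /weight_matrix mul_mx_diag !mxE.
congr (_ + _); last congr (_ * _).
  by apply: eq_bigr => k _; rewrite mxE.
by apply: eq_bigr => k _; rewrite !mxE expr2 mulrA [x _ _ * _]mulrC.
Qed.

(** The value that makes the entries of the cut vector have sum n. *)
Definition cut_scale (R : realType) (V : finType) (S : {set V}) : R :=
  #|V|%:R / (#|S|%:R * #|~: S|%:R).

Definition cut_vector (R : realType) (V : finType) (S : {set V}) :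
    pair_vector R V :=
  \col_k (let p := val (enum_val k) in
          if separates S p.1 p.2 then cut_scale R S else 0).

Lemma entry_cut_vector (R : realType) (V : finType) (S : {set V}) (i j : V) :
  entry (cut_vector R S) i j = if separates S i j then cut_scale R S else 0.
Proof.
rewrite /entry; case: insubP => [p _ pE|nij].
  by rewrite /pair_coord mxE enum_rankK pE.
case: insubP => [p _ pE|nji].
  by rewrite /pair_coord mxE enum_rankK pE /separates /= eq_sym.
suff -> : i = j by rewrite /separates eqxx.
by apply/eqP/negPn/negP => ij; move: nji; rewrite /= (node_lt_total ij) nij.
Qed.

(** The scalar form of the bound on the quadratic cost, with k for the cut, n
    for the number of nodes and c for the scale: the part (1 - lam) c (c k) is
    at most c k since c <= 1, and the part lam n c is at most lam n c k since
    1 <= k. *)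
Lemma quadratic_cost_le (R : realFieldType) (c k n lam : R) :
    0 <= c -> c <= 1 -> 1 <= k -> 0 <= n -> 0 <= lam ->
  c * ((1 - lam) * (c * k) + lam * n) <= (1 + lam * n) * (c * k).
Proof.
move=> c0 c1 k1 n0 lam0; have k0 : 0 <= k by lra.
have ck_le : c * (c * k) <= c * k by rewrite ler_piMl // mulr_ge0.
have lck_ge0 : 0 <= lam * (c * (c * k)) by rewrite !mulr_ge0.
have lncut_ge0 : 0 <= lam * n * c * (k - 1) by rewrite !mulr_ge0 // subr_ge0.
lra.
Qed.

Section ProperCut.
Variables (R : realType) (V : finType) (S : {set V}).
Hypothesis S_proper : proper_cut S.

Lemma card_sides_gt0 : (0 < #|S|)%N /\ (0 < #|~: S|)%N.
Proof.
case: S_proper => S0 ST; rewrite !card_gt0; split=> //.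
by apply: contra ST => /eqP SC0; rewrite -(finset.setCK S) SC0 finset.setC0.
Qed.

Lemma cut_scaleK : cut_scale R S * (#|S|%:R * #|~: S|%:R) = #|V|%:R.
Proof.
have [s0 t0] := card_sides_gt0.
by rewrite /cut_scale divfK // mulf_neq0 // pnatr_eq0 -lt0n.
Qed.

Lemma cut_scale_ge0 : 0 <= cut_scale R S.
Proof. by rewrite /cut_scale divr_ge0 // mulr_ge0. Qed.

Lemma phi_cut_scale (e : rel V) : phi R e S = cut_scale R S * (cut e S)%:R.
Proof.
have [s0 t0] := card_sides_gt0.
rewrite /phi /cut_scale -(cardsC S) natrD.
by field; rewrite !pnatr_eq0 -!lt0n s0 t0.
Qed.

Lemma cut_vector_feasible : leighton_rao (cut_vector R S).
Proof.
split.
- under eq_bigr do under eq_bigr do rewrite entry_cut_vector /separates.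
  rewrite (@sum_separated _ V S (fun _ _ => cut_scale R S)) //.
  rewrite -cut_scaleK !sumr_const -mulrnA -natrM mulr_natr.
  by rewrite mulnC.
(* If i and j are separated, then k is separated from exactly one of them. *)
- move=> i j k _ _ _; rewrite !entry_cut_vector /separates.
  have := cut_scale_ge0.
  by case: (i \in S); case: (j \in S); case: (k \in S) => /= c0; lra.
- by move=> i j _; rewrite entry_cut_vector; case: ifP => // _;
     exact: cut_scale_ge0.
Qed.

(** Writing the weight of a pair as lam + (1 - lam) [edge], and using
    c |S| |~: S| = n once, turns the quadratic cost into a multiple of c. *)
Lemma qp_objective_cut_vector (e : rel V) (gam lam : R) :
    symmetric e ->
  qp_objective e gam lam (cut_vector R S) =
    phi R e S
    + 1 / (2 * gam) * (cut_scale R S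
        * ((1 - lam) * phi R e S + lam * #|V|%:R)).
Proof.
move=> e_sym; rewrite qp_objectiveE phi_cut_scale.
set c := cut_scale R S.
congr (_ + _ * _).
  transitivity (\sum_(i in S) \sum_(j in ~: S) c * (e i j)%:R).
    rewrite -sum_separated; last by move=> i j; rewrite e_sym.
    rewrite -sum_node_pair; apply: eq_bigr => k _; rewrite !mxE /separates.
    by case: ifP; case: ifP; rewrite ?mul1r ?mul0r ?mulr1 ?mulr0.
  by rewrite cutE mulr_sumr; apply: eq_bigr => i _; rewrite mulr_sumr.
transitivity (\sum_(i in S) \sum_(j in ~: S)
    (c ^+ 2 * (1 - lam) * (e i j)%:R + c ^+ 2 * lam)).
  rewrite -sum_separated; last by move=> i j; rewrite e_sym.
  rewrite -sum_node_pair; apply: eq_bigr => k _; rewrite !mxE /separates -/c.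
  by case: (e _ _); case: ifP => _ /=; ring.
under eq_bigr do rewrite big_split /= sumr_const -mulr_sumr.
rewrite big_split /= sumr_const -mulr_sumr -cutE -cut_scaleK -/c -mulrnA.
by rewrite -[_ *+ (_ * _)]mulr_natr natrM; ring.
Qed.

Lemma qp_objective_cut_vector_le (e : rel V) (gam lam : R) :
    symmetric e -> connected_graph e ->
    (2 <= #|S|)%N -> (2 <= #|~: S|)%N -> 0 < gam -> 0 < lam -> lam < 1 ->
  qp_objective e gam lam (cut_vector R S)
    <= (1 + (1 + lam * #|V|%:R) / (2 * gam)) * phi R e S.
Proof.
move=> e_sym e_conn s2 t2 gam0 lam0 lam1.
(* s + t <= s t as soon as 2 <= s and 2 <= t. *)
have c_le1 : cut_scale R S <= 1.
  have [s0 t0] := card_sides_gt0.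
  rewrite /cut_scale ler_pdivrMr ?mul1r -?natrM ?ltr0n ?muln_gt0 ?s0 //.
  rewrite ler_nat -(cardsC S); nia.
have c0 := cut_scale_ge0.
have cut1 : 1 <= (cut e S)%:R :> R by rewrite ler1n cut_gt0.
rewrite qp_objective_cut_vector // [leRHS]mulrDl !mul1r lerD2l.
rewrite [leRHS]mulrAC [leRHS]mulrC ler_wpM2l //.
  by rewrite invr_ge0 mulr_ge0 // ltW.
by rewrite phi_cut_scale quadratic_cost_le // ltW.
Qed.
End ProperCut.

(** * Existence of the minimum *)

Section Existence.
Variables (R : realType) (V : finType).
Local Open Scope classical_set_scope.
Import numFieldNormedType.Exports.
Notation N := #|{: node_pair V}|.

Lemma continuous_sumr (T : topologicalType) (I : Type) (r : seq I) (P : pred I)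
    (F : I -> T -> R) :
  (forall i, continuous (F i)) ->
  continuous (fun x => \sum_(i <- r | P i) F i x).
Proof. by move=> F_cont; apply: continuous_big => //; exact: add_continuous. Qed.

Lemma continuous_scale (T : topologicalType) (c : R) (f : T -> R) :
  continuous f -> continuous (fun x => c * f x).
Proof.
by move=> f_cont x; apply: continuousM; [exact: cst_continuous|exact: f_cont].
Qed.

Lemma coord_tr_continuous n (k : 'I_n) :
  continuous (fun y : 'rV[R]_n => y^T k ord0).
Proof. by under eq_fun do rewrite mxE; exact: coord_continuous. Qed.

Lemma continuous_entry (i j : V) :
  continuous (fun y : 'rV[R]_N => entry y^T i j).
Proof.
rewrite /entry; case: insubP => [p _ _|_].
  exact: coord_tr_continuous.
case: insubP => [p _ _|_]; last exact: cst_continuous.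
exact: coord_tr_continuous.
Qed.

Lemma closed_le_fun (T : topologicalType) (f g : T -> R) :
  continuous f -> continuous g -> closed [set x | f x <= g x].
Proof.
move=> f_cont g_cont.
have -> : [set x | f x <= g x] = (g \- f) @^-1` [set z | 0 <= z].
  by apply/seteqP; split=> x /=; rewrite subr_ge0.
apply: preimage_closed => [x _|]; last exact: closed_ge.
by apply: continuousB; [exact: g_cont|exact: f_cont].
Qed.

(** An entry is one of the nonnegative terms of a sum equal to n. *)
Lemma leighton_rao_entry_le (x : pair_vector R V) (i j : V) :
  leighton_rao x -> node_lt i j -> entry x i j <= #|V|%:R.
Proof.
move=> [<- _ x_ge0] ij.
have row_ge0 u (P : pred V) :
    (forall v, P v -> node_lt u v) -> 0 <= \sum_(v | P v) entry x u v.
  by move=> uP; apply: sumr_ge0 => v /uP /node_lt_neq /x_ge0.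
rewrite (bigD1 i) //= (bigD1 j) //= -addrA lerDl addr_ge0 //.
  by apply: row_ge0 => v /andP[].
by apply: sumr_ge0 => u _; exact: row_ge0.
Qed.

(** The region is cut out by one equation and finitely many weak inequalities
    between continuous functions of the coordinates. *)
Lemma leighton_rao_rows_closed :
  closed [set y : 'rV[R]_N | leighton_rao y^T].
Proof.
pose total (y : 'rV[R]_N) := \sum_i \sum_(j | node_lt i j) entry y^T i j.
have total_cont : continuous total.
  by do 2![apply: continuous_sumr => ?]; exact: continuous_entry.
have -> : [set y : 'rV[R]_N | leighton_rao y^T] =
    (total @^-1` [set z | z = #|V|%:R])
    `&` ((\bigcap_(t in [set t : V * V * V |
              [/\ t.1.1 != t.1.2, t.1.1 != t.2 & t.1.2 != t.2]])
           [set y | entry y^T t.1.1 t.1.2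
                    <= entry y^T t.1.1 t.2 + entry y^T t.1.2 t.2])
    `&` \bigcap_(t in [set t : V * V | t.1 != t.2])
           [set y | 0 <= entry y^T t.1 t.2]).
  apply/seteqP; split=> [y [sum_y tri_y y_ge0]|y [sum_y [tri_y y_ge0]]].
    split=> //; split; first by move=> [[i j] k] [/= ij ik jk]; exact: tri_y.
    by move=> [i j] /= ij; exact: y_ge0.
  split=> // [i j k ij ik jk|i j ij]; first by apply: (tri_y (i, j, k)).
  by apply: (y_ge0 (i, j)).
apply: closedI; first by apply: preimage_closed => [y _|];
  [exact: total_cont|exact: closed_eq].
apply: closedI; apply: closed_bigI => t _.
  apply: closed_le_fun; first exact: continuous_entry.
  by move=> y; apply: continuousD; exact: continuous_entry.
by apply: closed_le_fun; [exact: cst_continuous|exact: continuous_entry].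
Qed.

(** The region is a closed subset of the box of vectors with all coordinates
    between 0 and n. *)
Lemma leighton_rao_rows_compact :
  compact [set y : 'rV[R]_N | leighton_rao y^T].
Proof.
have box_compact := @rV_compact R N (fun=> `[0, #|V|%:R])
  (fun=> @segment_compact R 0 #|V|%:R).
apply: (subclosed_compact leighton_rao_rows_closed box_compact) => y y_LR k.
have -> : y ord0 k = entry y^T (val (enum_val k)).1 (val (enum_val k)).2.
  by rewrite -pair_coord_entry mxE.
have k_lt := valP (enum_val k).
rewrite /= in_itv /= leighton_rao_entry_le // andbT.
by case: y_LR => _ _ -> //; exact: node_lt_neq.
Qed.

Lemma qp_objective_rows_continuous (e : rel V) (gam lam : R) :
  continuous (fun y : 'rV[R]_N => qp_objective e gam lam y^T).
Proof.
rewrite (funext (fun y : 'rV[R]_N => qp_objectiveE e gam lam y^T)).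
have linear_cont : continuous (fun y : 'rV[R]_N =>
    \sum_k cost_vector R e k ord0 * y^T k ord0).
  apply: continuous_sumr => k; apply: continuous_scale.
  exact: coord_tr_continuous.
have quadratic_cont : continuous (fun y : 'rV[R]_N =>
    \sum_k weight_vector e lam k ord0 * y^T k ord0 ^+ 2).
  apply: continuous_sumr => k; apply: continuous_scale.
  by move=> y; apply: continuousM; exact: coord_tr_continuous.
have scaled_cont := continuous_scale (c := 1 / (2 * gam)) quadratic_cont.
move=> y; have sum_cont := continuousD (linear_cont y) (scaled_cont y).
exact sum_cont.
Qed.

Lemma qp_objective_min_exists (e : rel V) (gam lam : R) (x0 : pair_vector R V) :
  leighton_rao x0 ->
  exists m, is_min_of (qp_objective e gam lam) (@leighton_rao R V) m.
Proof.
move=> x0_LR.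
have rows_nonempty : [set y : 'rV[R]_N | leighton_rao y^T] !=set0.
  by exists x0^T; rewrite /= trmxK.
have [y y_LR y_min] := compact_EVT_min rows_nonempty leighton_rao_rows_compact
  (continuous_subspaceT (@qp_objective_rows_continuous e gam lam)).
exists (qp_objective e gam lam y^T); split.
  by exists y^T => //; move: y_LR; rewrite inE.
move=> _ [x x_LR <-].
by have := y_min x^T; rewrite trmxK; apply; rewrite inE /= trmxK.
Qed.
End Existence.

(** * The bound *)

Theorem theorem4 (R : realType) (V : finType) (e : rel V)
    (e_sym : symmetric e) (e_irr : irreflexive e)
    (e_conn : connected_graph e) (V_gt4 : (4 < #|V|)%N)
    (phistar : R) (phistar_min : is_min_of (@phi R V e) (@proper_cut V) phistar)
    (Sstar : {set V}) (Sstar_proper : @proper_cut V Sstar)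
    (Sstar_opt : phi R e Sstar = phistar)
    (Sstar_ge2 : (2 <= #|Sstar|)%N) (SstarC_ge2 : (2 <= #|~: Sstar|)%N)
    (gam lam : R) (gam_gt0 : 0 < gam) (lam_gt0 : 0 < lam) (lam_lt1 : lam < 1) :
  exists m : R,
    is_min_of (qp_objective e gam lam) (@leighton_rao R V) m
    /\ m <= (1 + (1 + lam * #|V|%:R) / (2 * gam)) * phistar.
Proof.
have Sstar_feasible := cut_vector_feasible R Sstar_proper.
have [m m_min] := qp_objective_min_exists e gam lam Sstar_feasible.
exists m; split=> //; rewrite -Sstar_opt.
apply: le_trans (qp_objective_cut_vector_le _ _ _ _ _ _ _ _) => //.
by case: m_min => _; apply; exists (cut_vector R Sstar).
Qed.
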